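(* The groups $\Pi_7(\mathbf{k})$ have the $R_\infty$ property.
   Context: Let $A=[\ell_{ij}]\in\mathrm{SL}(2,\mathbb{Z})$ have trace $>2$. For $\mathbf{x}=(x,y)^t\in\mathbb{Z}^2$ write $\mathbf{a}^{\mathbf{x}}=a_1^xa_2^y$; for an integer matrix $B=[b_{ij}]$ write $B(a_i)=a_1^{b_{1i}}a_2^{b_{2i}}$. Let $M$ be a traceless integer matrix with determinant $1$ and $MAM^{-1}=A^{-1}$, and let $\mathbf{k}\in\mathbb{Z}^2$ represent a class in $\mathbb{Z}^2/(\mathrm{im}(M+A^{-1})+\mathrm{im}(I-A^{-1}))$. Then $$\Pi_7(\mathbf{k})=\langle a_1,a_2,t,\alpha\mid [a_1,a_2]=1,\ ta_it^{-1}=A(a_i),\ \alpha a_i\alpha^{-1}=M(a_i),\ \alpha^4=1,\ \alpha t\alpha^{-1}=\mathbf{a}^{\mathbf{k}}t^{-1}\rangle.$$ The Reidemeister number $R(\varphi)$ of an endomorphism $\varphi$ of a group $G$ is the number (possibly $\infty$) of equivalence classes of the relation $\alpha\sim\gamma\alpha\varphi(\gamma)^{-1}$ ($\gamma\in G$) on $G$. $G$ has the $R_\infty$ property if $R(\varphi)=\infty$ for every automorphism $\varphi$ of $G$. *)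

(* Defs.v *)
From HB Require Import structures.
From mathcomp Require Import all_boot all_order all_algebra.
From mathcomp Require Import finmap.
From mathcomp Require Import boolp classical_sets cardinality constructive_ereal.

Set Implicit Arguments.
Unset Strict Implicit.
Unset Printing Implicit Defensive.

Local Open Scope classical_set_scope.
Local Open Scope quotient_scope.
Local Open Scope group_scope.

(* A letter is a generator together with a sign: (x, false) stands for x and
   (x, true) for its formal inverse. *)
Definition word (X : Type) : Type := seq (X * bool).

Definition letter (X : Type) (x : X) : word X := [:: (x, false)].

Definition word_inv (X : Type) (w : word X) : word X :=
  rev [seq (l.1, ~~ l.2) | l <- w].

Section Words.
Variable X : choiceType.

HB.instance Definition _ := Choice.copy (word X) (seq (X * bool)).

Lemma word_invK : involutive (@word_inv X).
Proof.
move=> w; rewrite /word_inv map_rev revK -map_comp.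
by rewrite -[RHS]map_id; apply: eq_map => -[x b] /=; rewrite negbK.
Qed.

Lemma word_invM : {morph @word_inv X : u v / u ++ v >-> v ++ u}.
Proof. by move=> u v; rewrite /word_inv map_cat rev_cat. Qed.

(* Unreduced words: a monoid with a formal inversion, which only becomes a
   group after quotienting by [pres_eq] below. *)
HB.instance Definition _ :=
  isStarMonoid.Build (word X) (@catA _) (@cat0s _) word_invK word_invM.

End Words.

(* The congruence on words generated by free cancellation and the relations. *)
Inductive pres_eq (X : choiceType) (rels : word X -> word X -> Prop) :
    word X -> word X -> Prop :=
| pres_eq_rel u v : rels u v -> pres_eq rels u v
| pres_eq_cancel (x : X) (b : bool) : pres_eq rels [:: (x, b); (x, ~~ b)] 1
| pres_eq_mul u u' v v' :
    pres_eq rels u u' -> pres_eq rels v v' -> pres_eq rels (u * v) (u' * v')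
| pres_eq_refl u : pres_eq rels u u
| pres_eq_sym u v : pres_eq rels u v -> pres_eq rels v u
| pres_eq_trans u v w :
    pres_eq rels u v -> pres_eq rels v w -> pres_eq rels u w.

Section Presented.
Variables (X : choiceType) (rels : word X -> word X -> Prop).

Definition pres_eqb (u v : word X) : bool := `[< pres_eq rels u v >].

Lemma pres_eqb_refl : reflexive pres_eqb.
Proof. by move=> u; apply/asboolP; apply: pres_eq_refl. Qed.

Lemma pres_eqb_sym : symmetric pres_eqb.
Proof.
by move=> u v; apply/asboolP/asboolP; apply: pres_eq_sym.
Qed.

Lemma pres_eqb_trans : transitive pres_eqb.
Proof.
move=> v u w /asboolP uv /asboolP vw; apply/asboolP.
exact: pres_eq_trans uv vw.
Qed.

Canonical pres_equiv :=
  EquivRel pres_eqb pres_eqb_refl pres_eqb_sym pres_eqb_trans.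

(* The group < X | u = v for all u, v with rels u v >. *)
Definition presented : Type := {eq_quot pres_eqb}.

HB.instance Definition _ := Choice.on presented.
HB.instance Definition _ := EqQuotient.on presented.

Lemma presentedP (u v : word X) :
  reflect (pres_eq rels u v) (\pi_presented u == \pi_presented v).
Proof. by rewrite eqmodE; apply: asboolP. Qed.

Lemma pres_eq_mulV (w : word X) : pres_eq rels (w * w^-1) 1.
Proof.
elim/last_ind: w => [|w [x b] IH]; first exact: pres_eq_refl.
apply: pres_eq_trans IH.
have -> : (rcons w (x, b) : word X) * (rcons w (x, b) : word X)^-1 =
    (w : word X) * ([:: (x, b); (x, ~~ b)] : word X) * (w : word X)^-1.
  pose l : word X := [:: (x, b)].
  rewrite -cats1 -[w ++ _]/((w : word X) * l) invgM !mulgA.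
  by rewrite -[_ * l * l^-1]mulgA.
apply: pres_eq_mul (pres_eq_refl _ _).
rewrite -[X in pres_eq _ _ X](mulg1 (w : word X)).
by apply: pres_eq_mul (pres_eq_refl _ _) _; apply: pres_eq_cancel.
Qed.

Lemma pres_eq_inv (u v : word X) :
  pres_eq rels u v -> pres_eq rels u^-1 v^-1.
Proof.
move=> uv.
have h1 : pres_eq rels u^-1 (u^-1 * (v * v^-1)).
  rewrite -[X in pres_eq _ X]mulg1.
  by apply: pres_eq_mul (pres_eq_refl _ _) (pres_eq_sym (pres_eq_mulV v)).
apply: pres_eq_trans h1 _; rewrite mulgA -[X in pres_eq _ _ X]mul1g.
apply: pres_eq_mul (pres_eq_refl _ _).
apply: (@pres_eq_trans _ _ _ (u^-1 * u)).
  by apply: pres_eq_mul (pres_eq_refl _ _) (pres_eq_sym uv).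
by have := pres_eq_mulV u^-1; rewrite invgK.
Qed.

Definition pres_one : presented := \pi_presented 1.
Definition pres_mul (g h : presented) : presented := \pi_presented (repr g * repr h).
Definition pres_inv (g : presented) : presented := \pi_presented (repr g)^-1.

Lemma pres_repr (w : word X) : pres_eq rels (repr (\pi_presented w)) w.
Proof. by apply/presentedP; rewrite reprK. Qed.

Lemma pi_pres_mul (u v : word X) :
  pres_mul (\pi_presented u) (\pi_presented v) = \pi_presented (u * v).
Proof. by apply/eqP/presentedP/pres_eq_mul; apply: pres_repr. Qed.

Lemma pi_pres_inv (u : word X) : pres_inv (\pi_presented u) = \pi_presented u^-1.
Proof. by apply/eqP/presentedP/pres_eq_inv/pres_repr. Qed.

Lemma pres_mulA : associative pres_mul.
Proof.
move=> f g h; rewrite -[f]reprK -[g]reprK -[h]reprK.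
by rewrite !pi_pres_mul !reprK mulgA.
Qed.

Lemma pres_mul1 : left_id pres_one pres_mul.
Proof. by move=> g; rewrite -[g]reprK /pres_one pi_pres_mul mul1g. Qed.

Lemma pres_mulr1 : right_id pres_one pres_mul.
Proof. by move=> g; rewrite -[g]reprK /pres_one pi_pres_mul mulg1. Qed.

Lemma pres_mulVr : right_inverse pres_one pres_inv pres_mul.
Proof.
move=> g; rewrite -[g]reprK pi_pres_inv pi_pres_mul.
by apply/eqP/presentedP/pres_eq_mulV.
Qed.

Lemma pres_mulVl : left_inverse pres_one pres_inv pres_mul.
Proof.
move=> g; rewrite -[g]reprK pi_pres_inv pi_pres_mul.
by apply/eqP/presentedP; have := pres_eq_mulV (repr g)^-1; rewrite invgK.
Qed.

HB.instance Definition _ := isGroup.Build presented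
  pres_mulA pres_mul1 pres_mulr1 pres_mulVl pres_mulVr.

End Presented.

Definition zexpg (G : baseGroupType) (x : G) (z : int) : G :=
  match z with Posz n => x ^+ n | Negz n => x ^- n.+1 end.

Inductive Pi7_gen : Type := Ga of 'I_2 | Gt | Galpha.

HB.instance Definition _ := gen_eqMixin Pi7_gen.
HB.instance Definition _ := gen_choiceMixin Pi7_gen.

Definition wa (i : 'I_2) : word Pi7_gen := letter (Ga i).
Definition wt : word Pi7_gen := letter Gt.
Definition walpha : word Pi7_gen := letter Galpha.

Definition wa_vec (x : 'cV[int]_2) : word Pi7_gen :=
  zexpg (wa 0%R) (x 0%R 0%R) * zexpg (wa 1%R) (x 1%R 0%R).

(* B(a_i) is read off the i-th column of B. *)
Definition wa_mx (B : 'M[int]_2) (i : 'I_2) : word Pi7_gen :=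
  wa_vec (col i B).

Inductive Pi7_rel (A M : 'M[int]_2) (k : 'cV[int]_2) :
    word Pi7_gen -> word Pi7_gen -> Prop :=
| Pi7_rel_comm : Pi7_rel A M k [~ wa 0%R, wa 1%R] 1
| Pi7_rel_t i : Pi7_rel A M k (wt * wa i * wt^-1) (wa_mx A i)
| Pi7_rel_alpha i : Pi7_rel A M k (walpha * wa i * walpha^-1) (wa_mx M i)
| Pi7_rel_alpha4 : Pi7_rel A M k (walpha ^+ 4) 1
| Pi7_rel_alphat :
    Pi7_rel A M k (walpha * wt * walpha^-1) (wa_vec k * wt^-1).

Definition Pi7 (A M : 'M[int]_2) (k : 'cV[int]_2) : groupType :=
  presented (Pi7_rel A M k).

Definition reidemeister_class (G : groupType) (phi : {multiplicative G -> G})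
    (x : G) : set G :=
  [set y | exists g : G, y = g * x * (phi g)^-1].

Definition reidemeister_classes (G : groupType)
    (phi : {multiplicative G -> G}) : set (set G) :=
  [set reidemeister_class phi x | x in [set: G]].

Definition reidemeister_number (G : groupType)
    (phi : {multiplicative G -> G}) : \bar nat :=
  if `[< finite_set (reidemeister_classes phi) >]
  then (#|` fset_set (reidemeister_classes phi) |)%fset%:E else +oo%E.

Definition R_infinity (G : groupType) : Prop :=
  forall phi : {multiplicative G -> G},
    bijective phi -> reidemeister_number phi = +oo%E.

(* Main.v *)
Require Import Defs.
From mathcomp Require Import all_boot all_order all_algebra.
From HB Require Import structures.
From mathcomp Require Import boolp classical_sets cardinality constructive_ereal.
From mathcomp Require Import zify.

(** The group [Pi7 A M k] maps onto the infinite dihedral group by killing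
    [a_1] and [a_2]: there [t] becomes the unit translation and [alpha] a
    reflection.  The point is that every automorphism [phi] descends to this
    quotient, after which one is reduced to the (easy) fact that automorphisms
    of the infinite dihedral group have infinitely many twisted conjugacy
    classes.

    Why [phi] descends.  Let [p] be the projection and [f := p \o phi], a
    surjection onto the infinite dihedral group ([pi7_surjectionE] treats any
    such surjection).  Put [u = f a_1], [v = f a_2]; they commute.
    - If [u] or [v] is a reflection [r], both lie in the subgroup [{1, r}],
      since commuting with a reflection [r] means lying in [{1, r}].
      Conjugating by [f t] and [f alpha] sends [r] back into [{1, r}], so [r]
      would be central in the image, which is everything; but the infinite
      dihedral group has trivial centre ([pi7_translations]).
    - So [u] and [v] are translations, by [c] and [d] say.  Conjugation by
      [f alpha] multiplies the row vector [(c, d)] by a sign [e], and by the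
      relations it also multiplies it by [M].  As [M] has trace 0 and
      determinant 1, [det (M - e) = 2] is nonzero, whence [c = d = 0]
      ([traceless_no_sign_eigenvector]).
    Hence [f] kills the [a_i].  Surjectivity onto a nonabelian group then forces
    [f t] to be a translation [n |-> n + e] and [f alpha] a reflection
    [n |-> m - n], and [e] to be 1 or -1.

    Counting classes.  The twisted class of [x] is seen through [p x].  If
    [e = 1], twisted conjugation moves the translation by [n] only to those by
    [n] and [- n - m]; if [e = -1], it moves the reflection [x |-> n - x] only to
    itself and [x |-> (m - n) - x].  So [`|2 n + m|], respectively [`|2 n - m|], is
    an invariant taking infinitely many values. *)

Set Implicit Arguments.
Unset Strict Implicit.
Unset Printing Implicit Defensive.

Import GRing.Theory.

Local Open Scope classical_set_scope.
Local Open Scope quotient_scope.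
Local Open Scope group_scope.

(** * The infinite dihedral group *)

(** [Isom n b] is the isometry [x |-> n + x] or [x |-> n - x] of the integers,
    according to whether [b] is [false] or [true]. *)
Inductive dihedral : Type := Isom of int & bool.

HB.instance Definition _ := gen_eqMixin dihedral.
HB.instance Definition _ := gen_choiceMixin dihedral.

Definition dihedral_mul (x y : dihedral) : dihedral :=
  let: Isom m b := x in let: Isom n c := y in
  Isom (m + if b then - n else n)%R (b (+) c).
Definition dihedral_inv (x : dihedral) : dihedral :=
  let: Isom m b := x in Isom (if b then m else - m)%R b.
Definition dihedral_one : dihedral := Isom 0%R false.

Lemma dihedral_mulA : associative dihedral_mul.
Proof. by move=> [x []] [y []] [z []] /=; congr Isom; lia. Qed.

Lemma dihedral_mul1 : left_id dihedral_one dihedral_mul.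
Proof. by move=> [x []] /=; congr Isom => /=; lia. Qed.

Lemma dihedral_mulr1 : right_id dihedral_one dihedral_mul.
Proof. by move=> [x []] /=; congr Isom => /=; lia. Qed.

Lemma dihedral_mulV : left_inverse dihedral_one dihedral_inv dihedral_mul.
Proof. by move=> [x []] /=; congr Isom => /=; lia. Qed.

Lemma dihedral_mulVr : right_inverse dihedral_one dihedral_inv dihedral_mul.
Proof. by move=> [x []] /=; congr Isom => /=; lia. Qed.

HB.instance Definition _ := isGroup.Build dihedral
  dihedral_mulA dihedral_mul1 dihedral_mulr1 dihedral_mulV dihedral_mulVr.

Lemma dihedral1E : 1 = Isom 0%R false.
Proof. by []. Qed.

Lemma dihedralM (m n : int) (b c : bool) :
  Isom m b * Isom n c = Isom (m + if b then - n else n)%R (b (+) c).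
Proof. by []. Qed.

Lemma dihedralV (m : int) (b : bool) :
  (Isom m b)^-1 = Isom (if b then m else - m)%R b.
Proof. by []. Qed.

Lemma zexpg1 (G : groupType) (z : int) : zexpg (1 : G) z = 1.
Proof. by case: z => n; rewrite /zexpg expg1n ?invg1. Qed.

Lemma zexpg_translation (c z : int) :
  zexpg (Isom c false) z = Isom (c * z)%R false.
Proof.
have expE n : (Isom c false) ^+ n = Isom (c * Posz n)%R false.
  elim: n => [|n IH]; first by rewrite expg0 mulr0.
  by rewrite expgS IH dihedralM; congr Isom; lia.
by case: z => n; rewrite /zexpg expE // dihedralV; congr Isom; lia.
Qed.

Definition in_reflection_subgroup (n : int) (w : dihedral) : Prop :=
  w = 1 \/ w = Isom n true.

Lemma reflection_subgroupM (n : int) (w w' : dihedral) :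
  in_reflection_subgroup n w -> in_reflection_subgroup n w' ->
  in_reflection_subgroup n (w * w').
Proof.
case=> -> [] ->; rewrite ?mul1g ?mulg1; [by left | by right | by right |].
by left; rewrite dihedralM subrr.
Qed.

Lemma reflection_subgroup_zexpg (n z : int) (w : dihedral) :
  in_reflection_subgroup n w -> in_reflection_subgroup n (zexpg w z).
Proof.
move=> w_r; have wX_r m : in_reflection_subgroup n (w ^+ m).
  by elim: m => [|m IH]; [left | rewrite expgS; apply: reflection_subgroupM].
case: z => m; rewrite /zexpg //.
by case: (wX_r m.+1) => ->; [left; rewrite invg1 | right].
Qed.

(** The reflections [x |-> m - x] and [x |-> n - x] multiply to the translation by
    [m - n] or [n - m], according to the order, and the translation by [m]
    conjugates [x |-> n - x] to [x |-> (n + 2 m) - x]. *)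
Lemma commute_reflection (n : int) (w : dihedral) :
  commute w (Isom n true) -> in_reflection_subgroup n w.
Proof.
by case: w => m [] [] h; [right | left; rewrite dihedral1E]; congr Isom; lia.
Qed.

(** Conjugation by the translation by [m] takes [x |-> - x] to [x |-> 2 m - x],
    and a reflection inverts the translations. *)
Lemma dihedral_centre1 (w : dihedral) : (forall x, commute w x) -> w = 1.
Proof.
move=> cw; case: w cw => m [] cw.
  by have [] := cw (Isom 1%R false); lia.
by have [h] := cw (Isom 0%R true); rewrite dihedral1E; congr Isom; lia.
Qed.

(** The endomorphism of the infinite dihedral group sending the unit translation
    to the translation by [e] and [x |-> - x] to [x |-> m - x]. *)
Definition dihedral_endo (e m : int) (x : dihedral) : dihedral :=
  let: Isom n b := x in Isom (e * n + if b then m else 0)%R b.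

Lemma dihedral_endo1 (e m : int) : dihedral_endo e m 1 = 1.
Proof. by rewrite dihedral1E; congr Isom => /=; lia. Qed.

Lemma dihedral_endoM (e m : int) : {morph dihedral_endo e m : x y / x * y}.
Proof. by move=> [n []] [n' []]; congr Isom => /=; lia. Qed.

Lemma dihedral_endoV (e m : int) : {morph dihedral_endo e m : x / x^-1}.
Proof. by move=> [n []]; congr Isom => /=; lia. Qed.

(** * Morphisms of groups *)

Section GroupMorphisms.
Variables (G H : groupType) (f : {multiplicative G -> H}).

Lemma group_gmulf1 : f 1 = 1.
Proof. by apply: (@mulgI _ (f 1)); rewrite -gmulfM !mulg1. Qed.

Lemma group_gmulfV : {morph f : x / x^-1}.
Proof. by move=> x; apply/esym/mulg1_eq; rewrite -gmulfM mulgV group_gmulf1. Qed.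

Lemma group_gmulf_zexpg (z : int) : {morph f : x / zexpg x z}.
Proof.
have fX n : {morph f : x / x ^+ n}.
  by elim: n => [|n IH] x; rewrite ?expg0 ?group_gmulf1 // !expgS gmulfM IH.
by case: z => n x; rewrite /zexpg ?group_gmulfV fX.
Qed.

End GroupMorphisms.

(** * Morphisms from presented groups *)

Section PresentedMorphisms.
Variables (X : choiceType) (rels : word X -> word X -> Prop).
Local Notation G := (presented rels).

Lemma presented_piM (u v : word X) : \pi_G (u * v) = \pi_G u * \pi_G v.
Proof. exact/esym/pi_pres_mul. Qed.

Lemma presented_piV (u : word X) : \pi_G u^-1 = (\pi_G u)^-1.
Proof. exact/esym/pi_pres_inv. Qed.

Lemma presented_rel (u v : word X) : rels u v -> \pi_G u = \pi_G v.
Proof. by move=> uv; apply/eqP/presentedP/pres_eq_rel. Qed.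

Lemma presented_pi_zexpg (u : word X) (z : int) :
  \pi_G (zexpg u z) = zexpg (\pi_G u) z.
Proof.
have piX n : \pi_G (u ^+ n) = \pi_G u ^+ n.
  by elim: n => [|n IH]; rewrite ?expg0 // !expgS presented_piM IH.
by case: z => n; rewrite /zexpg ?presented_piV piX.
Qed.

Lemma presented_ind (P : G -> Prop) :
  P 1 -> (forall g h, P g -> P h -> P (g * h)) -> (forall g, P g -> P g^-1) ->
  (forall x, P (\pi_G (letter x))) -> forall g, P g.
Proof.
move=> P1 PM PV Px g; rewrite -[g]reprK; elim: (repr g) => [|[x b] w IH] //.
rewrite -[(x, b) :: w]/(([:: (x, b)] : word X) * w) presented_piM; apply: PM => //.
case: b; last exact: Px.
by rewrite -[[:: _]]/(letter x)^-1 presented_piV; apply: PV.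
Qed.

Variables (H : groupType) (f : X -> H).

Definition word_eval (w : word X) : H :=
  foldr (fun l h => (if l.2 then (f l.1)^-1 else f l.1) * h) 1 w.

Lemma word_evalM (u v : word X) : word_eval (u * v) = word_eval u * word_eval v.
Proof.
elim: u => [|l u IH]; first by rewrite mul1g [RHS]mul1g.
by rewrite /word_eval /= -/(word_eval (u ++ v)) -mulgA -IH.
Qed.

(** The universal property of the presentation. *)
Lemma presented_lift :
  (forall u v, rels u v -> word_eval u = word_eval v) ->
  exists F : {multiplicative G -> H}, forall x, F (\pi_G (letter x)) = f x.
Proof.
move=> frel.
have eval_eq u v : pres_eq rels u v -> word_eval u = word_eval v.
  elim=> {u v} //.
  - by move=> x [] /=; rewrite mulg1 ?mulVg ?mulgV.
  - by move=> u u' v v' _ IHu _ IHv; rewrite !word_evalM IHu IHv.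
  - by move=> u v w _ -> _ ->.
pose F (g : G) := word_eval (repr g).
have FE u : F (\pi_G u) = word_eval u by apply/eval_eq/pres_repr.
have FM : {morph F : g h / g * h}.
  by move=> g h; rewrite -[g]reprK -[h]reprK -presented_piM !FE word_evalM.
pose FMm := isMultiplicative.Build G H F FM.
exists (HB.pack_for {multiplicative G -> H} F FMm) => x.
by rewrite -[LHS]/(F _) FE /= mulg1.
Qed.

End PresentedMorphisms.

(** * Surjections of [Pi7 A M k] onto the infinite dihedral group *)

Section Pi7Generators.
Variables (A M : 'M[int]_2) (k : 'cV[int]_2).
Local Notation G := (presented (Pi7_rel A M k)).

Definition pi7_a (i : 'I_2) : Pi7 A M k := \pi_G (wa i).
Definition pi7_t : Pi7 A M k := \pi_G wt.
Definition pi7_alpha : Pi7 A M k := \pi_G walpha.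

Definition zexpg_col (H : groupType) (u : 'I_2 -> H) (x : 'cV[int]_2) : H :=
  zexpg (u 0%R) (x 0%R 0%R) * zexpg (u 1%R) (x 1%R 0%R).

Lemma pi7_ind (P : Pi7 A M k -> Prop) :
  P 1 -> (forall g h, P g -> P h -> P (g * h)) -> (forall g, P g -> P g^-1) ->
  (forall i, P (pi7_a i)) -> P pi7_t -> P pi7_alpha -> forall g, P g.
Proof.
by move=> P1 PM PV Pa Pt Palpha; apply: presented_ind => // -[i||] //; apply: Pa.
Qed.

Section Image.
Variables (H : groupType) (f : {multiplicative Pi7 A M k -> H}).

Lemma gmulf_wa_vec (x : 'cV[int]_2) :
  f (\pi_G (wa_vec x)) = zexpg_col (f \o pi7_a) x.
Proof. by rewrite presented_piM gmulfM !presented_pi_zexpg !group_gmulf_zexpg. Qed.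

Lemma pi7_commute_a (i j : 'I_2) : commute (f (pi7_a i)) (f (pi7_a j)).
Proof.
have c01 : commute (f (pi7_a 0%R)) (f (pi7_a 1%R)).
  have := congr1 f (presented_rel (Pi7_rel_comm A M k)).
  rewrite !presented_piM !presented_piV -/(pi7_a 0%R) -/(pi7_a 1%R).
  by rewrite !gmulfM !group_gmulfV => /eqP; rewrite group_gmulf1 => /commgP.
have ordE (l : 'I_2) : l = 0%R \/ l = 1%R.
  by case: l => [[|[|l]] hl] //; [left | right]; apply: val_inj.
by case: (ordE i) => ->; case: (ordE j) => ->; rewrite /commute ?c01.
Qed.

Lemma pi7_conj_t (i : 'I_2) :
  f pi7_t * f (pi7_a i) * (f pi7_t)^-1 = zexpg_col (f \o pi7_a) (col i A).
Proof.
rewrite -gmulf_wa_vec -(presented_rel (Pi7_rel_t A M k i)).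
by rewrite !presented_piM presented_piV !gmulfM group_gmulfV.
Qed.

Lemma pi7_conj_alpha (i : 'I_2) :
  f pi7_alpha * f (pi7_a i) * (f pi7_alpha)^-1 =
  zexpg_col (f \o pi7_a) (col i M).
Proof.
rewrite -gmulf_wa_vec -(presented_rel (Pi7_rel_alpha A M k i)).
by rewrite !presented_piM presented_piV !gmulfM group_gmulfV.
Qed.

Lemma pi7_conj_alphat :
  f pi7_alpha * f pi7_t * (f pi7_alpha)^-1 =
  zexpg_col (f \o pi7_a) k * (f pi7_t)^-1.
Proof.
have := congr1 f (presented_rel (Pi7_rel_alphat A M k)).
rewrite -gmulf_wa_vec /wa_vec.
by rewrite !presented_piM !presented_piV !gmulfM !group_gmulfV.
Qed.

End Image.

(** Once the [a_i] are sent to 1 the relations say that [alpha ^+ 4 = 1] and that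
    [alpha] inverts [t], as [x |-> - x] does for the unit translation. *)
Lemma pi7_dihedral_projection : exists p : {multiplicative Pi7 A M k -> dihedral},
  [/\ forall i, p (pi7_a i) = 1, p pi7_t = Isom 1%R false
    & p pi7_alpha = Isom 0%R true].
Proof.
pose f (x : Pi7_gen) : dihedral := match x with
  Ga _ => 1 | Gt => Isom 1%R false | Galpha => Isom 0%R true end.
have evalX n i : word_eval f (wa i ^+ n) = 1.
  by elim: n => [|n IH] //; rewrite expgS word_evalM IH mulg1 /= mulg1.
have evalVX n i : word_eval f (wa i ^- n) = 1.
  rewrite -expVgn; elim: n => [|n IH] //.
  by rewrite expgS word_evalM IH mulg1 /= mulg1 invg1.
have evalZ i z : word_eval f (zexpg (wa i) z) = 1.
  by case: z => n; [apply: evalX | apply: evalVX].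
have [|p pE] := @presented_lift _ (Pi7_rel A M k) _ f.
  by move=> u v [] => *; rewrite /wa_mx ?word_evalM ?evalZ.
exists p; split=> [i||]; exact: pE.
Qed.

End Pi7Generators.

(** The matrix [M - e] has determinant [1 - e * 0 + e ^+ 2 = 2], so it is
    injective on row vectors. *)
Lemma traceless_no_sign_eigenvector (M : 'M[int]_2) (e c d : int) :
  (\tr M = 0)%R -> (\det M = 1)%R -> e = 1%R \/ e = (-1)%R ->
  (c * M 0%R 0%R + d * M 1%R 0%R = e * c)%R ->
  (c * M 0%R 1%R + d * M 1%R 1%R = e * d)%R ->
  c = 0%R /\ d = 0%R.
Proof.
have det2 : (\det M = M 0 0 * M 1 1 - M 0 1 * M 1 0)%R.
  rewrite (expand_det_row _ ord0) !big_ord_recl big_ord0 /cofactor !det_mx11 !mxE.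
  rewrite /= expr0 expr1 mul1r mulN1r mulrN addr0.
  by congr (_ * M _ _ - M _ _ * M _ _)%R; apply: val_inj.
have tr2 : (\tr M = M 0 0 + M 1 1)%R.
  rewrite /mxtrace !big_ord_recl big_ord0 addr0.
  by congr (_ + M _ _)%R; apply: val_inj.
rewrite det2 tr2.
move: (M 0 0)%R (M 0 1)%R (M 1 0)%R (M 1 1)%R => q r s t trM detM eE Ec Ed.
have {}trM : t = (- q)%R by lia.
rewrite {}trM in detM Ed.
have Ec' z : ((c * q + d * s) * z = e * c * z)%R by rewrite Ec.
have Ed' z : ((c * r + d * - q) * z = e * d * z)%R by rewrite Ed.
have det' z : ((q * - q - r * s) * z = z)%R by rewrite detM mul1r.
move: (Ec' q) (Ec' r) (Ed' s) (Ed' q) (det' c) (det' d).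
by case: eE => -> in Ec Ed *; lia.
Qed.

Section DihedralSurjection.
Variables (A M : 'M[int]_2) (k : 'cV[int]_2).
Variable f : {multiplicative Pi7 A M k -> dihedral}.
Hypothesis f_surj : forall x, exists g, f g = x.

Local Notation a := (pi7_a A M k).
Local Notation t := (pi7_t A M k).
Local Notation alpha := (pi7_alpha A M k).

(** By surjectivity, [w] is in the centre of the infinite dihedral group. *)
Lemma image_centre1 (w : dihedral) :
  (forall i, commute w (f (a i))) -> commute w (f t) ->
  commute w (f alpha) -> w = 1.
Proof.
move=> wa wt walpha; apply: dihedral_centre1 => x.
have [g <-] := f_surj x; elim/pi7_ind: g => //.
- by rewrite group_gmulf1; apply: commute1.
- by move=> g h; rewrite gmulfM; apply: commuteM.
- by move=> g; rewrite group_gmulfV; apply: commuteV.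
Qed.

(** Otherwise [f t] and [f alpha] would commute with all generators of the
    image, hence be trivial, leaving a trivial image. *)
Lemma image_nonabelian :
  (forall i, f (a i) = 1) -> ~ commute (f alpha) (f t).
Proof.
move=> fa1 c_alpha_t.
have ft1 : f t = 1.
  apply: image_centre1 => [i||]; [|exact: commute_refl|exact: commute_sym].
  by rewrite fa1; apply: commute1.
have falpha1 : f alpha = 1.
  apply: image_centre1 => [i|//|]; last exact: commute_refl.
  by rewrite fa1; apply: commute1.
suff : Isom 1%R false = 1 by [].
by apply: image_centre1 => [i||]; rewrite ?fa1 ?ft1 ?falpha1; apply: commute1.
Qed.

(** If [f (a i)] were a reflection [r], the images of the [a j] would generate
    [{1, r}] and conjugation by the images of [t] and [alpha] would fix [r],
    making [r] central in the image. *)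
Lemma pi7_translations (i : 'I_2) : exists c, f (a i) = Isom c false.
Proof.
case fai: (f (a i)) => [n []]; last by exists n.
have fa_r j : in_reflection_subgroup n (f (a j)).
  by apply: commute_reflection; rewrite -fai; apply: pi7_commute_a.
have vec_r x : in_reflection_subgroup n (zexpg_col (f \o a) x).
  by apply: reflection_subgroupM; apply: reflection_subgroup_zexpg; apply: fa_r.
have c_conj (w : dihedral) :
    in_reflection_subgroup n (w * Isom n true * w^-1) -> commute (Isom n true) w.
  case=> h; have := canRL (mulgVK w) h; last exact: esym.
  by rewrite mul1g -[RHS]mulg1 => /mulgI.
suff : Isom n true = 1 by [].
apply: image_centre1 => [j||].
- by rewrite -fai; apply: pi7_commute_a.
- by apply: c_conj; rewrite -fai pi7_conj_t.
- by apply: c_conj; rewrite -fai pi7_conj_alpha.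
Qed.

(** Conjugation by [f alpha] acts on translations by a sign, and on the pair of
    translations [f (a 0), f (a 1)] through the columns of [M]. *)
Lemma pi7_kills_a (trM : (\tr M = 0)%R) (detM : (\det M = 1)%R) (i : 'I_2) :
  f (a i) = 1.
Proof.
have [c fa0] := pi7_translations 0%R; have [d fa1] := pi7_translations 1%R.
have vecE x : zexpg_col (f \o a) x =
    Isom (c * x 0%R 0%R + d * x 1%R 0%R)%R false.
  by rewrite /zexpg_col /= fa0 fa1 !zexpg_translation dihedralM.
have [e eE conjE] : exists2 e : int, e = 1%R \/ e = (-1)%R &
    forall z, f alpha * Isom z false * (f alpha)^-1 = Isom (e * z)%R false.
  case: (f alpha) => m []; [exists (-1)%R | exists 1%R]; auto => z;
    rewrite dihedralV !dihedralM /=; congr Isom; lia.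
have := pi7_conj_alpha f 0%R; rewrite fa0 conjE vecE !mxE => -[Ec].
have := pi7_conj_alpha f 1%R; rewrite fa1 conjE vecE !mxE => -[Ed].
have [c0 d0] := traceless_no_sign_eigenvector trM detM eE (esym Ec) (esym Ed).
have [-> | ->] : i = 0%R \/ i = 1%R; last 2 first.
- by rewrite fa0 c0.
- by rewrite fa1 d0.
by case: i => [[|[|l]] hi] //; [left | right]; apply: val_inj.
Qed.

Variable p : {multiplicative Pi7 A M k -> dihedral}.
Hypotheses (pa1 : forall i, p (a i) = 1) (pt : p t = Isom 1%R false)
  (palpha : p alpha = Isom 0%R true).

(** Once the [a_i] are killed, the relation [alpha t alpha^-1 = t^-1] makes
    [f alpha] and [f t] commute unless [f alpha] is a reflection and [f t] a
    translation; the latter must then generate all translations. *)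
Lemma pi7_surjectionE (trM : (\tr M = 0)%R) (detM : (\det M = 1)%R) :
  exists e m : int, (e = 1%R \/ e = (-1)%R) /\
    forall g, f g = dihedral_endo e m (p g).
Proof.
have fa1 := pi7_kills_a trM detM.
have := pi7_conj_alphat f.
rewrite /zexpg_col /= !fa1 !zexpg1 !mul1g => conj_t.
have := image_nonabelian fa1.
case ft: (f t) conj_t => [e b]; case falpha: (f alpha) => [m b'] conj_t not_comm.
have [b0 b1] : b = false /\ b' = true.
  move: b b' conj_t not_comm {ft falpha}.
  by case=> [] [] // [h] []; congr Isom => /=; lia.
rewrite b0 in ft; rewrite b1 in falpha.
have fE g : f g = dihedral_endo e m (p g).
  elim/pi7_ind: g => [|g h|g|i||].
  - by rewrite !group_gmulf1 dihedral_endo1.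
  - by rewrite !gmulfM dihedral_endoM => -> ->.
  - by rewrite !group_gmulfV dihedral_endoV => ->.
  - by rewrite fa1 pa1 dihedral_endo1.
  - by rewrite ft pt /=; congr Isom; lia.
  - by rewrite falpha palpha /=; congr Isom; lia.
exists e, m; split=> //.
have [g] := f_surj (Isom 1%R false); rewrite fE.
case: (p g) => n [] //= [] /(congr1 absz); rewrite addr0 abszM => /eqP.
by rewrite muln_eq1 => /andP[/eqP]; lia.
Qed.

End DihedralSurjection.

(** * Twisted conjugacy classes *)

Lemma reidemeister_number_infty (G : groupType) (phi : {multiplicative G -> G})
    (x : nat -> G) (I : G -> nat) :
  (forall g y, I (g * y * (phi g)^-1) = I y) -> injective (I \o x) ->
  reidemeister_number phi = +oo%E.
Proof.
move=> I_inv Ix_inj; rewrite /reidemeister_number; case: asboolP => // fin.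
case: infinite_nat.
have class_inj : injective (reidemeister_class phi \o x).
  move=> m n /= mn; apply: Ix_inj.
  have : reidemeister_class phi (x m) (x m).
    by exists 1; rewrite group_gmulf1 invg1 mulg1 mul1g.
  by rewrite mn /= => -[g ->]; rewrite I_inv.
have -> : [set: nat] = (reidemeister_class phi \o x) @^-1` reidemeister_classes phi.
  by apply/seteqP; split=> // n _; exists (x n).
by apply: finite_preimage => // m n _ _; apply: class_inj.
Qed.

(** For [e = 1] the twisted class of the translation by [n] consists of the
    translations by [n] and [- n - m]; for [e = -1] that of the reflection
    [x |-> n - x] consists of itself and [x |-> (m - n) - x]. *)
Definition twisted_invariant (e m : int) (x : dihedral) : nat :=
  let: Isom n b := x in
  if e == 1%R then if b then 0 else absz (2 * n + m)%R
  else if b then absz (2 * n - m)%R else 0.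

Lemma twisted_invariantJ (e m : int) (x y : dihedral) :
  e = 1%R \/ e = (-1)%R ->
  twisted_invariant e m (x * y * (dihedral_endo e m x)^-1) =
  twisted_invariant e m y.
Proof.
by case=> ->; case: x => s []; case: y => n [] //=; lia.
Qed.

Local Open Scope ring_scope.

Theorem theorem9p2 (A M : 'M[int]_2) (k : 'cV[int]_2)
    (detA : \det A = 1) (trA : 2 < \tr A)
    (trM : \tr M = 0) (detM : \det M = 1)
    (MAM : M *m A *m invmx M = invmx A) :
  R_infinity (Pi7 A M k).
Proof.
move=> phi [psi _ phiK].
have [p [pa pt palpha]] := pi7_dihedral_projection A M k.
pose f : Pi7 A M k -> dihedral := p \o phi.
have fM : {morph f : g h / (g * h)%g} by move=> g h; rewrite /f /= !gmulfM.
have p_surj x : exists g, p g = x.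
  case: x => n b; exists (zexpg (pi7_t A M k) n * pi7_alpha A M k ^+ b)%g.
  rewrite gmulfM group_gmulf_zexpg pt zexpg_translation mul1r.
  by case: b; rewrite ?expg1 ?palpha ?expg0 ?group_gmulf1 dihedralM /=;
    congr Isom; lia.
pose fm : {multiplicative Pi7 A M k -> dihedral} :=
  HB.pack_for {multiplicative Pi7 A M k -> dihedral} f
    (isMultiplicative.Build _ _ f fM).
have f_surj x : exists g, fm g = x.
  by have [g <-] := p_surj x; exists (psi g); rewrite /= /f /= phiK.
have [e [m [eE fE]]] := pi7_surjectionE f_surj pa pt palpha trM detM.
(* The shift by [|m|] keeps [2 n + m] and [2 n - m] nonnegative. *)
pose w (n : nat) := Isom (n%:Z + (absz m)%:Z) (e != 1).
have [x xE] := choice (fun n => p_surj (w n)).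
apply: (@reidemeister_number_infty _ phi x (twisted_invariant e m \o p)).
  move=> g y /=; rewrite !gmulfM group_gmulfV -[p (phi g)]/(fm g) fE.
  exact: twisted_invariantJ.
by move=> n n' /=; rewrite !xE /w /=; case: eE => -> /=; lia.
Qed.
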